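(* Let $Q$ be a Zamolodchikov integrable bipartite recurrent quiver with bigraph $G(Q)=(\Gamma,\Delta)$, and let $\hat\Lambda$ be a connected component of $\Gamma$ isomorphic to an affine $ADE$ Dynkin diagram. Then for every map $\lambda:\mathrm{Vert}(Q)\to\mathbb{Z}$ there exist integers $\mathrm{SPEED}^+_{\hat\Lambda}(\lambda)$ and $\mathrm{SPEED}^-_{\hat\Lambda}(\lambda)$ such that: (i) for all $t\gg0$ and all $v\in\hat\Lambda$ with $t+\epsilon_v$ even, $\ \mathfrak{t}^\lambda_v(t+2h_a(\hat\Lambda))=\mathfrak{t}^\lambda_v(t)+\theta(\hat\Lambda)\,\mathrm{SPEED}^+_{\hat\Lambda}(\lambda)\,\mathbf{v}(v)$; (ii) for all $t\ll0$ and all $v\in\hat\Lambda$ with $t+\epsilon_v$ even, $\ \mathfrak{t}^\lambda_v(t-2h_a(\hat\Lambda))=\mathfrak{t}^\lambda_v(t)+\theta(\hat\Lambda)\,\mathrm{SPEED}^-_{\hat\Lambda}(\lambda)\,\mathbf{v}(v)$.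
   Context: A quiver $Q$ is a finite directed graph (multiple arrows allowed) without loops and directed $2$-cycles. Mutation $\mu_v(Q)$: for each pair of arrows $u\to v\to w$ add $u\to w$; reverse all arrows at $v$; cancel directed $2$-cycles. A bipartition is a map $\epsilon:\mathrm{Vert}(Q)\to\{0,1\}$ with $\epsilon_u\neq\epsilon_v$ for every arrow $u\to v$. $Q$ is (bipartite) recurrent if mutating at all vertices with $\epsilon=0$, as well as mutating at all vertices with $\epsilon=1$, gives $Q$ with all arrows reversed. $T$-system: $T_v(t)\in\mathbb{Q}(\mathbf{x})$, $\mathbf{x}=(x_v)_{v\in\mathrm{Vert}(Q)}$, for $t\in\mathbb{Z}$ with $t+\epsilon_v$ even, $T_v(\epsilon_v)=x_v$, $T_v(t+1)T_v(t-1)=\prod_{u\to v}T_u(t)+\prod_{v\to w}T_w(t)$ (over arrows). $Q$ is Zamolodchikov integrable if for every $v$ there are $N$ and $J_0,\dots,J_N\in\mathbb{Q}(\mathbf{x})$, $J_0,J_N\ne0$, with $\sum_{j=0}^NJ_jT_v(t+2j)=0$ for all $t$ with $t+\epsilon_v$ even. $G(Q)=(\Gamma,\Delta)$: two undirected (multi)graphs on $\mathrm{Vert}(Q)$; $\Gamma$ has an edge for each arrow $u\to v$ with $\epsilon_u=0,\epsilon_v=1$; $\Delta$ has an edge for each arrow $u\to v$ with $\epsilon_u=1,\epsilon_v=0$. Tropical $T$-system with initial data $\lambda$: the integers $\mathfrak{t}^\lambda_v(t)$, for $t+\epsilon_v$ even, determined by $\mathfrak{t}^\lambda_v(\epsilon_v)=\lambda(v)$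 and $\mathfrak{t}^\lambda_v(t+1)+\mathfrak{t}^\lambda_v(t-1)=\max\bigl(\sum_{(u,v)\in\Gamma}\mathfrak{t}^\lambda_u(t),\sum_{(v,w)\in\Delta}\mathfrak{t}^\lambda_w(t)\bigr)$ (sums over edges with multiplicity). Affine $ADE$ diagrams: $\hat A_n$ (cycle with $n+1$ vertices; $\hat A_1$ is a double edge), $\hat D_n$ ($n\ge4$), $\hat E_6,\hat E_7,\hat E_8$. For such $\hat\Lambda$ (bipartite), $\mathbf{v}:\mathrm{Vert}(\hat\Lambda)\to\mathbb{Z}_{>0}$ is the positive integer vector with greatest common divisor of entries $1$ and $2\mathbf{v}(v)=\sum_{(u,v)\in\hat\Lambda}\mathbf{v}(u)$ for all $v$. The numbers $(h_a(\hat\Lambda),\theta(\hat\Lambda))$ are: $\hat A_{2n-1}$: $(n,2)$; $\hat D_{2n}$: $(2n-2,1)$; $\hat D_{2n+1}$: $(2(2n-1),2)$; $\hat E_6$: $(6,1)$; $\hat E_7$: $(12,1)$; $\hat E_8$: $(30,1)$. *)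

(* Defs.v *)
From HB Require Import structures.
From mathcomp Require Import all_boot all_order all_algebra.
From mathcomp Require Import mpoly.

Set Implicit Arguments.
Unset Strict Implicit.
Unset Printing Implicit Defensive.

Import Order.TTheory GRing.Theory Num.Theory.

(* [Q u v] is the number of arrows u -> v. *)
Record quiver (V : finType) := Quiver {
  arrows :> V -> V -> nat;
  quiver_loopless : forall v, arrows v v = 0;
  quiver_no2cycle : forall u v, arrows u v = 0 \/ arrows v u = 0
}.

Section Quivers.
Variable V : finType.
Implicit Types (Q : quiver V) (eps : V -> bool).

(* The arrows u -> w with u, w != v once the composites u -> v -> w are added,
   before the 2-cycles are cancelled. *)
Definition composed_arrows v Q u w : nat := Q u w + Q u v * Q v w.

(* The truncated subtraction cancels the 2-cycles. *)
Definition mutate_arrows v Q u w : nat :=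
  if (u == v) || (w == v) then Q w u
  else composed_arrows v Q u w - composed_arrows v Q w u.

Lemma mutate_loopless v Q u : mutate_arrows v Q u u = 0.
Proof.
by rewrite /mutate_arrows subnn quiver_loopless if_same.
Qed.

Lemma mutate_no2cycle v Q u w :
  mutate_arrows v Q u w = 0 \/ mutate_arrows v Q w u = 0.
Proof.
rewrite /mutate_arrows [(w == v) || _]orbC; case: ifP => _.
  exact: quiver_no2cycle.
case/orP: (leq_total (composed_arrows v Q u w) (composed_arrows v Q w u)).
  by rewrite -subn_eq0 => /eqP; left.
by rewrite -subn_eq0 => /eqP; right.
Qed.

Definition mutate v Q : quiver V :=
  Quiver (mutate_loopless v Q) (mutate_no2cycle v Q).

(* The colour 0 is [false], the colour 1 is [true]. *)
Definition bipartition Q eps : Prop :=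
  forall u v, 0 < Q u v -> eps u != eps v.

(* For a bipartition, the vertices of one colour are pairwise non-adjacent and
   stay so, hence the order of the mutations is immaterial. *)
Definition mutate_colour eps (b : bool) Q : quiver V :=
  foldl (fun Q' v => mutate v Q') Q [seq v <- enum V | eps v == b].

Definition recurrent Q eps : Prop :=
  forall (b : bool) u v, mutate_colour eps b Q u v = Q v u.

Local Open Scope ring_scope.

(* The parity condition "t + eps_v is even". *)
Definition on_lattice eps (v : V) (t : int) : bool :=
  (2 %| t + (eps v : nat)%:Z)%Z.

(* The field Q(x), with one indeterminate per vertex. *)
Definition ratfun : fieldType := {fraction {mpoly rat[#|V|]}}.

Definition xvar (v : V) : ratfun :=
  FracField.tofrac ('X_(enum_rank v) : {mpoly rat[#|V|]}).

(* The values of [T v t] with t + eps_v odd are irrelevant. *)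
Definition T_system Q eps (T : V -> int -> ratfun) : Prop :=
  (forall v, T v (eps v : nat)%:Z = xvar v) /\
  (forall v t, ~~ on_lattice eps v t ->
     T v (t + 1) * T v (t - 1) =
       \prod_(u : V) T u t ^+ Q u v + \prod_(w : V) T w t ^+ Q v w).

(* The T-system has exactly one solution, up to the irrelevant values. *)
Definition zamolodchikov_integrable Q eps : Prop :=
  exists2 T : V -> int -> ratfun, T_system Q eps T &
  forall v, exists (N : nat) (J : nat -> ratfun),
    [/\ J 0%N != 0, J N != 0 &
        forall t, on_lattice eps v t ->
          \sum_(0 <= j < N.+1) J j * T v (t + (2 * j)%N%:Z) = 0].

Local Close Scope ring_scope.

(* The bigraph: [Gamma Q eps u v] and [Delta Q eps u v] are the numbers of
   edges between u and v. *)
Definition Gamma Q eps u v : nat :=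
  (~~ eps u && eps v) * Q u v + (~~ eps v && eps u) * Q v u.

Definition Delta Q eps u v : nat :=
  (eps u && ~~ eps v) * Q u v + (eps v && ~~ eps u) * Q v u.

Local Open Scope ring_scope.

Definition tropical_T_system Q eps (lam : V -> int) (tr : V -> int -> int)
    : Prop :=
  (forall v, tr v (eps v : nat)%:Z = lam v) /\
  (forall v t, ~~ on_lattice eps v t ->
     tr v (t + 1) + tr v (t - 1) =
       Num.max (\sum_(u : V) tr u t *+ Gamma Q eps u v)
               (\sum_(w : V) tr w t *+ Delta Q eps v w)).

Local Close Scope ring_scope.

Definition connected_component (E : V -> V -> nat) (C : {set V}) : Prop :=
  exists x, C = [set y | connect (fun u v => 0 < E u v) x y].

(* The vector v of an affine ADE component C of the multigraph E. *)
Definition additive_vector (E : V -> V -> nat) (C : {set V}) (mv : V -> nat)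
    : Prop :=
  [/\ forall v, v \in C -> 0 < mv v,
      \big[gcdn/0]_(v in C) mv v = 1 &
      forall v, v \in C -> 2 * mv v = \sum_(u in C) E u v * mv u].

End Quivers.

(* [Ahat n] has n + 1 vertices. *)
Inductive affine_type := Ahat of nat | Dhat of nat | E6hat | E7hat | E8hat.

Definition affine_ADE (L : affine_type) : bool :=
  match L with
  | Ahat n => 1 <= n
  | Dhat n => 4 <= n
  | _ => true
  end.

Definition affine_order (L : affine_type) : nat :=
  match L with
  | Ahat n | Dhat n => n.+1
  | E6hat => 7 | E7hat => 8 | E8hat => 9
  end.

(* The edges, with multiplicity: [Ahat 1] gets the two edges (0, 1), (1, 0).
   In [Dhat n] the leaves 0, 1 hang at 2 and the leaves n - 1, n at n - 2.
   The E diagrams have arms of lengths (2, 2, 2), (3, 3, 1) and (2, 5, 1). *)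
Definition affine_edges (L : affine_type) : seq (nat * nat) :=
  match L with
  | Ahat n => [seq (i, i.+1 %% n.+1) | i <- iota 0 n.+1]
  | Dhat n => (0, 2) :: (n - 2, n) :: [seq (i, i.+1) | i <- iota 1 (n - 2)]
  | E6hat => [:: (0, 1); (1, 2); (2, 3); (3, 4); (2, 5); (5, 6)]
  | E7hat => [:: (0, 1); (1, 2); (2, 3); (3, 4); (4, 5); (5, 6); (3, 7)]
  | E8hat => [:: (0, 1); (1, 2); (2, 3); (3, 4); (4, 5); (5, 6); (6, 7); (2, 8)]
  end.

Definition affine_adj (L : affine_type) (i j : nat) : nat :=
  count (fun e => (e == (i, j)) || (e == (j, i))) (affine_edges L).

(* The subgraph of the multigraph E induced on C is isomorphic to L. *)
Definition isomorphic_to (V : finType) (E : V -> V -> nat) (C : {set V})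
    (L : affine_type) : Prop :=
  exists f : 'I_(affine_order L) -> V,
    [/\ injective f, f @: [set: 'I_(affine_order L)] = C &
        forall i j, E (f i) (f j) = affine_adj L i j].

(* Only bipartite diagrams have a number h_a: the value at [Ahat n] is
   meaningful for odd n only. *)
Definition h_a (L : affine_type) : nat :=
  match L with
  | Ahat n => n.+1./2
  | Dhat n => if odd n then 2 * (n - 2) else n - 2
  | E6hat => 6 | E7hat => 12 | E8hat => 30
  end.

Definition theta (L : affine_type) : nat :=
  match L with
  | Ahat _ => 2
  | Dhat n => if odd n then 2 else 1
  | _ => 1
  end.

(* Main.v *)
Require Import Defs.
From HB Require Import structures.
From mathcomp Require Import all_boot all_order all_algebra.
From Stdlib Require Import Classical_Prop.
From mathcomp Require Import zify ring generic_quotient.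
From mathcomp Require Import mpoly.
Import Order.TTheory GRing.Theory Num.Theory.
Local Open Scope ring_scope.

(** Integrability forces linear growth, convexity turns linear growth into an
    honest linear recurrence on the affine component, and that recurrence is the
    dynamics of an affine Coxeter element, whose power is a translation along
    the additive vector.

    Growth.  The T-system is subtraction-free.  Give the variable x_v the weight
    lambda(v).  Leading coefficients of subtraction-free rational functions are
    positive, so no cancellation of leading terms can occur, and the weighted
    degree of T_v(t) satisfies exactly the tropical T-system: it equals the
    tropical value t_v(t) ([T_pos_vdeg]).  In a relation
    sum_j J_j T_v(t + 2j) = 0 whose coefficients are independent of t, every
    nonzero term is accompanied by another one of at least the same degree, since
    it has to be cancelled; hence t_v(t + 2N) exceeds some earlier value
    t_v(t + 2j) by at most a constant, and similarly backwards in time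
    ([recurrence_growth]).  So t_v(t) is bounded above by a linear function of
    the absolute value of t.

    Convexity.  Let S(t) be the sum of mv(v) t_v(t) over the component.  The
    maximum is at least its Gamma side, and mv is an eigenvector of the adjacency
    matrix with eigenvalue 2, so S(t + 1) + S(t - 1) >= 2 S(t).  An integer
    valued convex sequence below a linear function is eventually affine.  Then
    all the inequalities that were summed are equalities: on the component,
    t_v(t + 1) + t_v(t - 1) is eventually the sum of t_u(t) over the neighbours u
    of v in Gamma ([eventually_affine_component]).

    Linear dynamics.  Solutions X of X_i(k + 2) + X_i(k) = sum_j a_ij X_j(k + 1)
    on an affine diagram, called waves below, satisfy
    X_i(k + 2 h_a) = X_i(k) + theta s mark_i ([affine_quasi_periodic]).  On a
    cycle this is the discrete d'Alembert formula; a diagram of type D folds onto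
    a cycle; types E are settled by evolving a generic initial condition for
    2 h_a steps.

    Time runs in both directions by the same argument applied to the reversed
    sequence.  To avoid carrying parities through the convexity and linear
    algebra steps, the tropical values are first extended to all times
    ([straighten]), which preserves the recurrence. *)

Set Implicit Arguments.
Unset Strict Implicit.
Unset Printing Implicit Defensive.

(** * Weighted degrees of rational functions *)

Lemma fraction_quotient (R : idomainType) (x : {fraction R}) :
  exists n d : R, d != 0 /\ x = FracField.tofrac n / FracField.tofrac d.
Proof.
elim/quotW: x => r; exists (frac r).1, (frac r).2.
have d0 := denom_ratioP r; split=> //.
apply: (mulIf (x := FracField.tofrac (frac r).2)); first by rewrite tofrac_eq0.
rewrite mulfVK ?tofrac_eq0 //; unlock FracField.tofrac.
rewrite -[LHS]FracField.pi_mul /FracField.mulf /= !numden_Ratio ?oner_neq0 //.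
apply/eqmodP; rewrite /= /equivf /= !numden_Ratio ?oner_neq0 ?mulr1 //.
by rewrite mulrC.
Qed.

Section WeightedLead.
Variables (n : nat) (lam : 'I_n -> int).
Implicit Types (m : 'X_{1..n}) (p q : {mpoly rat[n]}).

Definition weight m : int := \sum_i lam i *+ m i.

Lemma weightD m1 m2 : weight (m1 + m2)%MM = weight m1 + weight m2.
Proof.
by rewrite /weight -big_split /=; apply: eq_bigr => i _; rewrite mnmDE mulrnDr.
Qed.

Lemma weightU i : weight U_(i)%MM = lam i.
Proof.
rewrite /weight (bigD1 i) //= mnm1E eqxx mulr1n big1 ?addr0 // => j ji.
by rewrite mnm1E eq_sym (negPf ji).
Qed.

(** Total order refining the weight: among the monomials of largest weight, the
    tie is broken by the monomial order, so that a polynomial has a single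
    leading coefficient whose sign can be tested. *)
Definition key m : int *l 'X_{1..n} := (weight m, m).

Lemma le_key m1 m2 : (key m1 <= key m2)%O =
  (weight m1 <= weight m2) && ((weight m2 <= weight m1) ==> (m1 <= m2)%O).
Proof. by rewrite lexi_pair. Qed.

Lemma key_inj : injective key.
Proof. by move=> m1 m2 []. Qed.

Lemma le_key_weight m1 m2 : (key m1 <= key m2)%O -> weight m1 <= weight m2.
Proof. by rewrite le_key => /andP[]. Qed.

Lemma le_keyD m1 m2 m3 m4 : (key m1 <= key m2)%O -> (key m3 <= key m4)%O ->
  (key (m1 + m3)%MM <= key (m2 + m4)%MM)%O.
Proof.
rewrite !le_key !weightD => /andP[w12 /implyP m12] /andP[w34 /implyP m34].
rewrite lerD //=; apply/implyP => w; apply: lem_add.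
  by apply: m12; lia.
by apply: m34; lia.
Qed.

Lemma key_addI m1 m2 m3 m4 : (key m1 <= key m2)%O -> (key m3 <= key m4)%O ->
  (m1 + m3 = m2 + m4)%MM -> m1 = m2 /\ m3 = m4.
Proof.
rewrite !le_key => /andP[w12 /implyP m12] /andP[w34 /implyP m34] E.
have W := congr1 weight E; rewrite !weightD in W.
have {m12}m12 : (m1 <= m2)%O by apply: m12; lia.
have {m34}m34 : (m3 <= m4)%O by apply: m34; lia.
move: m12; rewrite le_eqVlt => /predU1P[e|lt]; last first.
  by have := ltmc_le_add lt m34; rewrite E ltxx.
split=> //; move: E; rewrite e => /eqP; rewrite eqm_add2l => /eqP //.
Qed.

Definition leads p m :=
  m \in msupp p /\ forall m', m' \in msupp p -> (key m' <= key m)%O.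

Lemma leads_exists p : p != 0 -> exists m, leads p m.
Proof.
rewrite -msupp_eq0 /leads; elim: (msupp p : seq _) => // a s IH _.
have [->|/IH[m [ms mmax]]] := eqVneq s [::].
  by exists a; split=> [|m']; rewrite inE // => /eqP->.
have [am|ma] := leP (key a) (key m).
  exists m; split=> [|m']; rewrite inE ?ms ?orbT // => /predU1P[->//|].
  exact: mmax.
exists a; split=> [|m']; rewrite inE ?eqxx // => /predU1P[->//|/mmax le].
exact: le_trans le (ltW ma).
Qed.

Lemma leads_uniq p m1 m2 : leads p m1 -> leads p m2 -> m1 = m2.
Proof.
move=> [s1 le1] [s2 le2]; apply: key_inj; apply/le_anti.
by rewrite le1 ?le2.
Qed.

(** By [key_addI] the product of the leading monomials arises from a single pair
    of monomials, so its coefficient cannot cancel. *)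
Lemma mcoeff_leadsM p q m1 m2 : leads p m1 -> leads q m2 ->
  (p * q)@_(m1 + m2)%MM = p@_m1 * q@_m2.
Proof.
move=> [s1 le1] [s2 le2].
rewrite mpolyME (bigD1_seq (m1, m2)) /=; first last.
+ by rewrite allpairs_uniq => // -[? ?] [].
+ by rewrite allpairs_f.
rewrite mcoeffD mcoeffZ mcoeffX eqxx mulr1.
rewrite big_seq_cond raddf_sum /= big1 ?addr0 //.
move=> ab /andP[/allpairsP[[a b] /= [/le1 a1 /le2 b2 ->]] ne].
rewrite /= mcoeffZ mcoeffX.
case: eqP => [/(key_addI a1 b2)[ea eb]|_]; last by rewrite mulr0.
by rewrite ea eb eqxx in ne.
Qed.

Lemma leadsM p q m1 m2 : leads p m1 -> leads q m2 -> leads (p * q) (m1 + m2)%MM.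
Proof.
move=> l1 l2; have [s1 le1] := l1; have [s2 le2] := l2; split.
  by rewrite mcoeff_msupp (mcoeff_leadsM l1 l2) mulf_neq0 -?mcoeff_msupp.
by move=> m /msuppM_le /allpairsP[[a b] /= [/le1 ? /le2 ? ->]]; apply: le_keyD.
Qed.

(** The weighted degree is a relation, which leaves it undefined at 0 and lets
    [pos_wdeg] add the positivity of the leading coefficient. *)
Definition wdeg p (d : int) := exists2 m, leads p m & weight m = d.
Definition pos_wdeg p (d : int) := exists m, [/\ leads p m, weight m = d & 0 < p@_m].

Lemma pos_wdegW p d : pos_wdeg p d -> wdeg p d.
Proof. by move=> [m [l w _]]; exists m. Qed.

Lemma wdeg_exists p : p != 0 -> exists d, wdeg p d.
Proof. by move=> /leads_exists[m l]; exists (weight m), m. Qed.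

Lemma wdeg_neq0 p d : wdeg p d -> p != 0.
Proof. by move=> [m [+ _] _]; apply: contraTneq => ->; rewrite msupp0. Qed.

Lemma wdeg_uniq p d1 d2 : wdeg p d1 -> wdeg p d2 -> d1 = d2.
Proof. by move=> [m1 l1 <-] [m2 l2 <-]; rewrite (leads_uniq l1 l2). Qed.

Lemma wdegM p q d e : wdeg p d -> wdeg q e -> wdeg (p * q) (d + e).
Proof.
by move=> [m1 l1 <-] [m2 l2 <-]; exists (m1 + m2)%MM; [apply: leadsM|rewrite weightD].
Qed.

Lemma wdegD_le p q d e c : wdeg p d -> wdeg q e -> wdeg (p + q) c ->
  c <= Num.max d e.
Proof.
move=> [m1 [_ l1] <-] [m2 [_ l2] <-] [m [/msuppD_le + _] <-].
rewrite mem_cat le_max => /orP[/l1|/l2] /le_key_weight -> //.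
by rewrite orbT.
Qed.

Lemma pos_wdegM p q d e : pos_wdeg p d -> pos_wdeg q e -> pos_wdeg (p * q) (d + e).
Proof.
move=> [m1 [l1 <- c1]] [m2 [l2 <- c2]]; exists (m1 + m2)%MM.
by split; [apply: leadsM|rewrite weightD|rewrite (mcoeff_leadsM l1 l2) mulr_gt0].
Qed.

(** Positivity of the leading coefficients is what turns the inequality for the
    degree of a sum into an equality: this is the passage from sums to maxima. *)
Lemma pos_wdegD p q d e : pos_wdeg p d -> pos_wdeg q e ->
  pos_wdeg (p + q) (Num.max d e).
Proof.
move=> [m1 [l1 <- c1]] [m2 [l2 <- c2]].
wlog le12 : p q m1 m2 l1 l2 c1 c2 / (key m1 <= key m2)%O => [IH|].
  have [/(IH p q)|/ltW/(IH q p)] := leP (key m1) (key m2); first exact.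
  by rewrite addrC maxC; apply.
have [s1 le1] := l1; have [s2 le2] := l2.
have c : 0 < (p + q)@_m2.
  rewrite mcoeffD ltr_wpDl //.
  have [/le1 le21|/memN_msupp_eq0-> //] := boolP (m2 \in msupp p).
  suff -> : m2 = m1 by apply: ltW.
  by apply: key_inj; apply/le_anti; rewrite le12 le21.
exists m2; split=> //; last by rewrite max_r ?le_key_weight.
split=> [|m /msuppD_le]; first by rewrite mcoeff_msupp gt_eqF.
by rewrite mem_cat => /orP[/le1 /le_trans->|/le2].
Qed.

Lemma pos_wdeg1 : pos_wdeg 1 0.
Proof.
exists 0%MM; split; last by rewrite mcoeff1 eqxx.
  by split=> [|m]; rewrite msupp1 inE // => /eqP->.
by rewrite /weight big1 // => i _; rewrite mnm0E.
Qed.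

Lemma pos_wdegX i : pos_wdeg 'X_i (lam i).
Proof.
exists U_(i)%MM; split; last by rewrite mcoeffX eqxx.
  by split=> [|m]; rewrite msuppX inE // => /eqP->.
exact: weightU.
Qed.

Local Notation F := {fraction {mpoly rat[n]}}.
Local Notation "p %:F" := (FracField.tofrac p) (format "p %:F").
Implicit Types f g : F.

(** Degree of a numerator minus degree of a denominator; [vdeg_uniq] shows that
    the fraction chosen does not matter. *)
Definition vdeg f (d : int) := exists p q dp dq,
  [/\ f = p%:F / q%:F, wdeg p dp, wdeg q dq & d = dp - dq].
Definition pos_vdeg f (d : int) := exists p q dp dq,
  [/\ f = p%:F / q%:F, pos_wdeg p dp, pos_wdeg q dq & d = dp - dq].

Lemma pos_vdegW f d : pos_vdeg f d -> vdeg f d.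
Proof.
by move=> [p [q [dp [dq [? ? ? ?]]]]]; exists p, q, dp, dq; split=> //; apply: pos_wdegW.
Qed.

Lemma vdeg_neq0 f d : vdeg f d -> f != 0.
Proof.
move=> [p [q [dp [dq [-> /wdeg_neq0 p0 /wdeg_neq0 q0 _]]]]].
by rewrite mulf_neq0 ?invr_eq0 ?tofrac_eq0.
Qed.

Lemma vdeg_exists f : f != 0 -> exists d, vdeg f d.
Proof.
have [p [q [q0 ->]]] := fraction_quotient f.
have [-> /eqP|p0 _] := eqVneq p 0; first by rewrite tofrac0 mul0r.
have [dp wp] := wdeg_exists p0; have [dq wq] := wdeg_exists q0.
by exists (dp - dq), p, q, dp, dq.
Qed.

Lemma vdeg_uniq f d1 d2 : vdeg f d1 -> vdeg f d2 -> d1 = d2.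
Proof.
move=> [p [q [dp [dq [-> wp wq ->]]]]] [r [s [dr [ds [+ wr ws ->]]]]].
move/eqP; rewrite eqr_div ?tofrac_eq0 ?(wdeg_neq0 wq) ?(wdeg_neq0 ws) //.
rewrite -!tofracM tofrac_eq => /eqP E.
have := wdegM wr wq; rewrite -E => /(wdeg_uniq (wdegM wp ws)); lia.
Qed.

Lemma vdegM f g d e : vdeg f d -> vdeg g e -> vdeg (f * g) (d + e).
Proof.
move=> [p [q [dp [dq [-> wp wq ->]]]]] [r [s [dr [ds [-> wr ws ->]]]]].
exists (p * r), (q * s), (dp + dr), (dq + ds).
by split; [rewrite mulf_div !tofracM|exact: wdegM|exact: wdegM|ring].
Qed.

Lemma vdegD_le f g d e c : vdeg f d -> vdeg g e -> vdeg (f + g) c ->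
  c <= Num.max d e.
Proof.
move=> [p [q [dp [dq [-> wp wq ->]]]]] [r [s [dr [ds [-> wr ws ->]]]]] vc.
have q0 := wdeg_neq0 wq; have s0 := wdeg_neq0 ws; move: vc.
rewrite addf_div ?tofrac_eq0 // -!tofracM -tofracD => vc.
have z : p * s + r * q != 0.
  by have := vdeg_neq0 vc; rewrite mulf_eq0 negb_or tofrac_eq0 => /andP[].
have [t wt] := wdeg_exists z.
have := wdegD_le (wdegM wp ws) (wdegM wr wq) wt.
have /(vdeg_uniq vc) : vdeg ((p * s + r * q)%:F / (q * s)%:F) (t - (dq + ds)).
  by exists (p * s + r * q), (q * s), t, (dq + ds); split=> //; apply: wdegM.
lia.
Qed.

Lemma pos_vdegM f g d e : pos_vdeg f d -> pos_vdeg g e -> pos_vdeg (f * g) (d + e).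
Proof.
move=> [p [q [dp [dq [-> wp wq ->]]]]] [r [s [dr [ds [-> wr ws ->]]]]].
exists (p * r), (q * s), (dp + dr), (dq + ds).
by split; [rewrite mulf_div !tofracM|exact: pos_wdegM|exact: pos_wdegM|ring].
Qed.

Lemma pos_vdegV f d : pos_vdeg f d -> pos_vdeg f^-1 (- d).
Proof.
move=> [p [q [dp [dq [-> wp wq ->]]]]].
by exists q, p, dq, dp; split=> //; [rewrite invf_div|ring].
Qed.

Lemma pos_vdegD f g d e : pos_vdeg f d -> pos_vdeg g e ->
  pos_vdeg (f + g) (Num.max d e).
Proof.
move=> [p [q [dp [dq [-> wp wq ->]]]]] [r [s [dr [ds [-> wr ws ->]]]]].
have q0 := wdeg_neq0 (pos_wdegW wq); have s0 := wdeg_neq0 (pos_wdegW ws).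
rewrite addf_div ?tofrac_eq0 // -!tofracM -tofracD.
exists (p * s + r * q), (q * s), (Num.max (dp + ds) (dr + dq)), (dq + ds).
split=> //; [|exact: pos_wdegM|lia].
by apply: pos_wdegD; apply: pos_wdegM.
Qed.

Lemma pos_vdeg1 : pos_vdeg 1 0.
Proof.
by exists 1, 1, 0, 0; split=> //; [rewrite divff // tofrac_eq0 oner_neq0
  |exact: pos_wdeg1|exact: pos_wdeg1].
Qed.

Lemma pos_vdegX i : pos_vdeg ('X_i : {mpoly rat[n]})%:F (lam i).
Proof.
exists 'X_i, 1, (lam i), 0; split; last by rewrite subr0.
- by rewrite tofrac1 divr1.
- exact: pos_wdegX.
- exact: pos_wdeg1.
Qed.

Lemma pos_vdeg_exp f d k : pos_vdeg f d -> pos_vdeg (f ^+ k) (d *+ k).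
Proof.
move=> v; elim: k => [|k IH]; first by rewrite expr0 mulr0n; apply: pos_vdeg1.
by rewrite exprS mulrS; apply: pos_vdegM.
Qed.

Lemma pos_vdeg_prod (I : finType) (f : I -> F) (d : I -> int) (e : I -> nat) :
  (forall i, (0 < e i)%N -> pos_vdeg (f i) (d i)) ->
  pos_vdeg (\prod_i f i ^+ e i) (\sum_i d i *+ e i).
Proof.
move=> v; elim/big_ind2: _ => [||i _]; [exact: pos_vdeg1|by move=> *; apply: pos_vdegM|].
have [->|/v] := posnP (e i); first by rewrite expr0 mulr0n; apply: pos_vdeg1.
exact: pos_vdeg_exp.
Qed.

Lemma vdegN f d : vdeg f d -> vdeg (- f) d.
Proof.
move=> [p [q [dp [dq [-> [m [s l] wm] wq ->]]]]].
exists (- p), q, dp, dq; split=> //; first by rewrite tofracN mulNr.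
by exists m => //; split=> [|m']; rewrite (perm_mem (msuppN p)) //; apply: l.
Qed.

Lemma vdeg_sum (I : eqType) (r : seq I) (f : I -> F) c :
  vdeg (\sum_(i <- r) f i) c -> exists i e, [/\ i \in r, vdeg (f i) e & c <= e].
Proof.
elim: r c => [|i r IH] c; first by rewrite big_nil => /vdeg_neq0; rewrite eqxx.
rewrite big_cons.
have [->|s0] := eqVneq (\sum_(j <- r) f j) 0.
  by rewrite addr0 => v; exists i, c; rewrite inE eqxx.
have [b vb] := vdeg_exists s0; have [j [e [jr ve be]]] := IH b vb.
have [->|f0] := eqVneq (f i) 0.
  rewrite add0r => vc; exists j, e; rewrite inE jr orbT; split=> //.
  by rewrite (vdeg_uniq vc vb).
have [a va] := vdeg_exists f0.
move=> /(vdegD_le va vb); rewrite le_max => /orP[ca|cb].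
  by exists i, a; rewrite inE eqxx.
by exists j, e; rewrite inE jr orbT; split=> //; lia.
Qed.

(** A term whose degree exceeds those of all the others could not be cancelled by
    them. *)
Lemma vdeg_sum_eq0 (I : eqType) (r : seq I) (f : I -> F) i a :
  uniq r -> i \in r -> \sum_(j <- r) f j = 0 -> vdeg (f i) a ->
  exists j e, [/\ j \in r, j != i, vdeg (f j) e & a <= e].
Proof.
move=> ur ir; rewrite (bigD1_seq i) //= => /eqP; rewrite addr_eq0 => /eqP -> v.
have := vdegN v; rewrite opprK -big_filter => /vdeg_sum[j [e []]].
by rewrite mem_filter => /andP[ji jr] ve le; exists j, e.
Qed.

(** Not every coefficient of a linear recurrence is nonzero, so the bound ranges
    over those that have a degree. *)
Lemma vdeg_bounded (f : nat -> F) N :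
  exists c : nat, forall j d, (j <= N)%N -> vdeg (f j) d -> `|d| <= c%:Z.
Proof.
have bnd1 g : exists c : nat, forall d, vdeg g d -> `|d| <= c%:Z.
  have [->|/vdeg_exists[d vd]] := eqVneq g 0.
    by exists 0%N => d /vdeg_neq0; rewrite eqxx.
  by exists `|d|%N => e /(vdeg_uniq vd) <-; lia.
elim: N => [|N [c IH]].
  have [c cP] := bnd1 (f 0%N); exists c => j d; rewrite leqn0 => /eqP->.
  exact: cP.
have [c' cP] := bnd1 (f N.+1); exists (c + c')%N => j d.
rewrite leq_eqVlt => /predU1P[->/cP|/IH h /h]; lia.
Qed.

End WeightedLead.

(** * Tropical values grow at most linearly *)

Section Growth.
Variables (V : finType) (Q : quiver V) (eps : V -> bool).
Hypothesis Q_bip : bipartition Q eps.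

Lemma on_latticeD1 v t : on_lattice eps v (t + 1) = ~~ on_lattice eps v t.
Proof. by rewrite /on_lattice; lia. Qed.

Lemma on_latticeB1 v t : on_lattice eps v (t - 1) = ~~ on_lattice eps v t.
Proof. by rewrite /on_lattice; lia. Qed.

Lemma on_lattice_adj u v t : eps u != eps v ->
  on_lattice eps u t = ~~ on_lattice eps v t.
Proof. by rewrite /on_lattice; lia. Qed.

Lemma Gamma_true u v : eps v -> Gamma Q eps u v = Q u v.
Proof.
move=> ev; rewrite /Gamma ev /= mul0n addn0 andbT.
have [|/Q_bip] := posnP (Q u v); first by move=> ->; rewrite muln0.
by rewrite ev; case: (eps u) => //; rewrite mul1n.
Qed.

Lemma Gamma_false u v : ~~ eps v -> Gamma Q eps u v = Q v u.
Proof.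
move=> ev; rewrite /Gamma (negPf ev) /= andbF mul0n add0n.
have [|/Q_bip] := posnP (Q v u); first by move=> ->; rewrite muln0.
by rewrite (negPf ev); case: (eps u) => //; rewrite mul1n.
Qed.

Lemma Delta_true v w : eps v -> Delta Q eps v w = Q v w.
Proof.
move=> ev; rewrite /Delta ev /= andbF mul0n addn0.
have [|/Q_bip] := posnP (Q v w); first by move=> ->; rewrite muln0.
by rewrite ev; case: (eps w) => //; rewrite mul1n.
Qed.

Lemma Delta_false v w : ~~ eps v -> Delta Q eps v w = Q w v.
Proof.
move=> ev; rewrite /Delta (negPf ev) /= andbT mul0n add0n.
have [|/Q_bip] := posnP (Q w v); first by move=> ->; rewrite muln0.
by rewrite (negPf ev); case: (eps w) => //; rewrite mul1n.
Qed.

Lemma Gamma_adj u v : (0 < Gamma Q eps u v)%N -> eps u != eps v.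
Proof. by rewrite /Gamma; case: (eps u) (eps v) => [] []. Qed.

Lemma Gamma_sym u v : Gamma Q eps u v = Gamma Q eps v u.
Proof. by rewrite /Gamma addnC. Qed.

Variables (T : V -> int -> ratfun V) (TP : T_system Q eps T).
Variables (lam : V -> int) (tr : V -> int -> int).
Hypothesis trP : tropical_T_system Q eps lam tr.

Let wt (i : 'I_#|V|) := lam (enum_val i).
Let pv := pos_vdeg wt.

(** Which of Gamma and Delta collects the incoming arrows depends on the colour
    of v; the maximum hides this, so the tropical recurrence has the same shape
    as the recurrence for T. *)
Lemma tropical_max v t : ~~ on_lattice eps v t -> 
  tr v (t + 1) + tr v (t - 1) =
  Num.max (\sum_u tr u t *+ Q u v) (\sum_w tr w t *+ Q v w).
Proof.
move=> off; rewrite trP.2 //; have [ev|ev] := boolP (eps v).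
  by congr Num.max; apply: eq_bigr => u _; rewrite ?Gamma_true ?Delta_true.
by rewrite maxC; congr Num.max; apply: eq_bigr => u _;
  rewrite ?Gamma_false ?Delta_false.
Qed.

Lemma T_step v t : ~~ on_lattice eps v t ->
  (forall u, on_lattice eps u t -> pv (T u t) (tr u t)) ->
  (pv (T v (t - 1)) (tr v (t - 1)) -> pv (T v (t + 1)) (tr v (t + 1))) /\
  (pv (T v (t + 1)) (tr v (t + 1)) -> pv (T v (t - 1)) (tr v (t - 1))).
Proof.
move=> off IH.
have R : pv (T v (t + 1) * T v (t - 1)) (tr v (t + 1) + tr v (t - 1)).
  rewrite TP.2 // tropical_max //; apply: pos_vdegD; apply: pos_vdeg_prod => u uv.
    by apply: IH; rewrite (on_lattice_adj _ (Q_bip uv)).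
  by apply: IH; rewrite (on_lattice_adj _ (v := v)) // eq_sym Q_bip.
split=> w.
  have w0 := vdeg_neq0 (pos_vdegW w).
  rewrite -[T v (t + 1)](mulfK w0) -[tr v _](addrK (tr v (t - 1))).
  by apply: pos_vdegM => //; apply: pos_vdegV.
have w0 := vdeg_neq0 (pos_vdegW w).
rewrite -[T v (t - 1)](mulKf w0) -[tr v (t - 1)](addKr (tr v (t + 1))).
by apply: pos_vdegM => //; apply: pos_vdegV.
Qed.

(** The weighted degree commutes with the operations of the T-system because all
    the rational functions involved have positive leading coefficients; the
    induction spreads from the times 0 and 1 in both directions. *)
Lemma T_pos_vdeg v t : on_lattice eps v t -> pv (T v t) (tr v t).
Proof.
suff H (k : nat) w s : on_lattice eps w s -> - k%:Z <= s <= k%:Z + 1 ->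
    pv (T w s) (tr w s).
  by move=> on; apply: (H `|t|%N) => //; lia.
elim: k w s => [|k IH] w s on sk.
  have -> : s = (eps w : nat)%:Z by move: on; rewrite /on_lattice; lia.
  rewrite TP.1 trP.1 -[w in lam w]enum_rankK; exact: pos_vdegX.
have [sk2|sk2] := eqVneq s (k%:Z + 2).
  have e1 : s = k%:Z + 1 + 1 by rewrite sk2 -addrA.
  have off : ~~ on_lattice eps w (k%:Z + 1) by rewrite e1 on_latticeD1 in on.
  rewrite e1; apply: (T_step off _).1 => //.
    by move=> u ou; apply: IH => //; lia.
  by apply: IH; rewrite ?on_latticeB1 //; lia.
have [sk3|sk3] := eqVneq s (- k%:Z - 1).
  have off : ~~ on_lattice eps w (- k%:Z) by rewrite sk3 on_latticeB1 in on.
  rewrite sk3; apply: (T_step off _).2 => //.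
    by move=> u ou; apply: IH => //; lia.
  by apply: IH; rewrite ?on_latticeD1 //; lia.
by apply: IH => //; lia.
Qed.

(** The relation is read off once at its first term, which bounds the past by the
    future, and once at its last term, which bounds the future by the past.  The
    constant c does not depend on t because the coefficients J do not. *)
Lemma recurrence_growth v N (J : nat -> ratfun V) :
  J 0%N != 0 -> J N != 0 ->
  (forall t, on_lattice eps v t ->
     \sum_(0 <= j < N.+1) J j * T v (t + (2 * j)%N%:Z) = 0) ->
  exists c : nat, forall t, on_lattice eps v t ->
    (exists2 j, (0 < j <= N)%N & tr v t <= tr v (t + (2 * j)%N%:Z) + c%:Z) /\
    (exists2 j, (j < N)%N &
       tr v (t + (2 * N)%N%:Z) <= tr v (t + (2 * j)%N%:Z) + c%:Z).
Proof.
move=> J0 JN rec.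
have [c cP] := vdeg_bounded wt J N.
have [d0 v0] := vdeg_exists wt J0.
have [dN vN] := vdeg_exists wt JN.
have main t i d : on_lattice eps v t -> (i <= N)%N ->
    vdeg wt (J i) d ->
    exists2 j, (j <= N)%N && (j != i) &
      tr v (t + (2 * i)%N%:Z) <= tr v (t + (2 * j)%N%:Z) + (c + c)%N%:Z.
  move=> on iN vi.
  have vT j : pv (T v (t + (2 * j)%N%:Z)) (tr v (t + (2 * j)%N%:Z)).
    by apply: T_pos_vdeg; move: on; rewrite /on_lattice; lia.
  have := vdeg_sum_eq0 _ _ (rec t on) (vdegM vi (pos_vdegW (vT i))).
  rewrite iota_uniq mem_index_iota /= ltnS iN => -[] // j [e []].
  rewrite mem_index_iota /= ltnS => jN ji ve le; exists j; first by rewrite jN.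
  have [Jj|/vdeg_exists] := eqVneq (J j) 0.
    by move: (vdeg_neq0 ve); rewrite Jj mul0r eqxx.
  move=> /(_ wt)[dj vj].
  have := vdeg_uniq ve (vdegM vj (pos_vdegW (vT j))).
  have := cP _ _ iN vi; have := cP _ _ jN vj; lia.
exists (c + c)%N => t on; split.
  have [j /andP[jN j0] le] := main t 0%N d0 on (leq0n _) v0.
  exists j; first by rewrite lt0n j0.
  by move: le; rewrite muln0 addr0.
have [j /andP[jN j0] le] := main t N dN on (leqnn _) vN.
by exists j => //; rewrite ltn_neqAle j0.
Qed.

End Growth.

(** Every backward jump has length at least 2, so a value at time k costs at most
    k jumps, each worth c, before it lands among the first 2 N values. *)
Lemma lookback_linear_growth (Y : nat -> int) (N c : nat) :
  (forall k, exists2 j, (0 < j <= N)%N &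
     Y (k + 2 * N)%N <= Y (k + 2 * N - 2 * j)%N + c%:Z) ->
  exists a b : nat, forall k, Y k <= (a * k + b)%N%:Z.
Proof.
move=> back; exists c, (\sum_(i < 2 * N) `|Y i|%N)%N.
elim/ltn_ind => k IH; have [kN|Nk] := ltnP k (2 * N).
  by rewrite (bigD1 (Ordinal kN)) //=; lia.
have [j jN] := back (k - 2 * N)%N; rewrite subnK // => le.
have /IH : (k - 2 * j < k)%N by lia.
have : (c * (k - 2 * j) + c <= c * k)%N.
  by rewrite -mulnSr leq_mul2l; apply/orP; right; lia.
by move: le; lia.
Qed.

(** * Waves on cycles and on diagrams of types A and D *)

(** The discrete d'Alembert formula: Y (p+1) (k+1) - Y p k is constant along the
    lines p + k = constant, hence a function [al] of p + k of period 2 m.  Going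
    once around the cycle along p - k = constant adds up the values of [al] on one
    parity class modulo 2 m, each of them twice. *)
Lemma cyclic_wave (m : nat) (Y : nat -> nat -> int) :
  (forall p k, Y (p + 2 * m)%N k = Y p k) ->
  (forall p k, Y p.+1 k.+2 + Y p.+1 k = Y p k.+1 + Y p.+2 k.+1) ->
  exists s : bool -> int, forall p k,
    Y p (k + 2 * m)%N = Y p k + s (odd (p + k)) *+ 2.
Proof.
move=> per wv; pose al p := Y p.+1 1%N - Y p 0%N.
have alE p k : Y p.+1 k.+1 - Y p k = al (p + k)%N.
  elim: k p => [|k IH] p; first by rewrite addn0.
  by rewrite addnS -addSn -IH; have := wv p k; lia.
have alper q : al (q + 2 * m)%N = al q by rewrite /al -addSn !per.
pose S q := \sum_(j < m) al (q + 2 * j)%N.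
have SS q : S q.+2 = S q.
  have : S q.+2 + al q = al (q + 2 * m)%N + S q.
    rewrite [LHS]addrC [RHS]addrC /S -(big_ord_recr m (fun j => al (q + 2 * j)%N)).
    rewrite big_ord_recl /= muln0 addn0; congr (_ + _).
    by apply: eq_bigr => j _; congr al; rewrite /bump; lia.
  by rewrite alper; lia.
have SE q : S q = S (odd q).
  rewrite -[q in LHS]odd_double_half; elim: q./2 => [|h <-]; first by rewrite addn0.
  by rewrite doubleS !addnS SS.
(* Summing the increments along the diagonal through (p, k). *)
have shift r p k : Y (p + r)%N (k + r)%N = Y p k + \sum_(j < r) al (p + k + 2 * j)%N.
  elim: r => [|r IH]; first by rewrite !addn0 big_ord0 addr0.
  rewrite big_ord_recr /= addrA -IH.
  have -> : (p + k + 2 * r = p + r + (k + r))%N by lia.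
  by rewrite -alE !addnS addrC subrK.
(* The second half of the sum repeats the first by periodicity. *)
exists S => p k; rewrite -SE -per shift; congr (_ + _).
have -> : (2 * m = m + m)%N by lia.
rewrite big_split_ord /= mulr2n; congr (_ + _).
by apply: eq_bigr => j _; rewrite -[RHS]alper; congr al; lia.
Qed.

Lemma sum_if_eq (s : seq nat) (F : nat -> int) i : uniq s ->
  \sum_(a <- s) (if a == i then F a else 0) = if i \in s then F i else 0.
Proof.
move=> us; have [is_|ns] := boolP (i \in s).
  by rewrite (bigD1_seq i) //= eqxx big1 ?addr0 // => a /negPf->.
by rewrite big_seq big1 // => a as_; case: eqP => // E; rewrite E (negPf ns) in as_.
Qed.

(** The sum over edges rather than over vertices, which is how the explicit edge
    lists are evaluated. *)
Definition neighbour_sum (s : seq (nat * nat)) (X : nat -> int) i : int :=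
  \sum_(e <- s) ((if e.1 == i then X e.2 else 0) + (if e.2 == i then X e.1 else 0)).

Lemma affine_edges_ok L : affine_ADE L ->
  {in affine_edges L, forall e,
    [&& e.1 != e.2, e.1 < affine_order L & e.2 < affine_order L]%N}.
Proof.
case: L => [n n1|n n4|_|_|_]; try by apply/allP.
  move=> e /mapP[a]; rewrite mem_iota add0n /= => aN -> /=.
  rewrite aN ltn_pmod // !andbT.
  have [->|an] := eqVneq a n; first by rewrite modnn; case: n n1 {aN}.
  by rewrite modn_small; lia.
move: n4 => /= n4 e; rewrite /= !inE.
move=> /or3P[/eqP->|/eqP->|/mapP[a]]; rewrite ?mem_iota /=.
- by rewrite /=; lia.
- by rewrite /=; lia.
- by move=> aP -> /=; lia.
Qed.

Lemma affine_adj_sum L (X : nat -> int) i :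
  affine_ADE L ->
  \sum_(j < affine_order L) X j *+ affine_adj L i j =
  neighbour_sum (affine_edges L) X i.
Proof.
move=> /affine_edges_ok edgeP; rewrite /affine_adj /neighbour_sum.
under eq_bigr => j _.
  rewrite -sum1_count -sumrMnr (eq_bigr (fun _ => X j)) //.
  rewrite big_mkcond /=; over.
rewrite exchange_big /=; apply: eq_big_seq => -[a b] /edgeP /= /and3P[ab aN bN].
have pick c (cN : (c < affine_order L)%N) (P : pred nat) : P =1 pred1 c ->
    \sum_(j < affine_order L) (if P j then X j else 0) = X c.
  move=> PE; rewrite (bigD1 (Ordinal cN)) //= PE /= eqxx big1 ?addr0 // => j.
  by rewrite -val_eqE /= PE /= => /negPf->.
under eq_bigr => j _ do rewrite !xpair_eqE.
have [ai|ai] := eqVneq a i.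
  rewrite -ai [b == a]eq_sym (negPf ab) addr0.
  apply: (pick b bN (fun j => (true && (b == j)) || ((a == j) && false))) => j /=.
  by rewrite andbF orbF eq_sym.
have [bi|bi] := eqVneq b i; last by rewrite big1 ?addr0 // => j _; rewrite andbF.
rewrite add0r.
by apply: (pick a aN (fun j => (a == j) && true)) => j /=; rewrite andbT eq_sym.
Qed.

(** The equation satisfied by the tropical values once the maximum is always on
    the Gamma side, with no condition relating the parity of the time to the colour
    of the vertex. *)
Definition wave L (X : nat -> nat -> int) := forall i k, (i < affine_order L)%N ->
  X i k.+2 + X i k = \sum_(j < affine_order L) X j k.+1 *+ affine_adj L i j.

Lemma wave_neighbours L X i k : affine_ADE L -> wave L X -> (i < affine_order L)%N ->
  X i k.+2 + X i k = neighbour_sum (affine_edges L) (X^~ k.+1) i.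
Proof.
by move=> Lok wv iN; rewrite wv // (affine_adj_sum (X^~ k.+1)).
Qed.

(** The coefficients of the minimal imaginary root, that is, the explicit value of
    the additive vector. *)
Definition marks (L : affine_type) (i : nat) : nat :=
  match L with
  | Ahat _ => 1
  | Dhat n => if (1 < i < n.-1)%N then 2 else 1
  | E6hat => nth 0%N [:: 1; 2; 3; 2; 1; 2; 1] i
  | E7hat => nth 0%N [:: 1; 2; 3; 4; 3; 2; 1; 2] i
  | E8hat => nth 0%N [:: 2; 4; 6; 5; 4; 3; 2; 1; 3] i
  end.

(** The function [c] will be a proper 2-colouring of the diagram.  A wave restricts to two
    independent evolutions, according to the parity of time plus colour, and each
    has its own speed. *)
Definition quasi_periodic L := exists c : nat -> bool, forall X, wave L X ->
  exists s : bool -> int, forall i k, (i < affine_order L)%N ->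
    X i (k + 2 * h_a L)%N =
      X i k + (theta L)%:Z * s (c i (+) odd k) * (marks L i)%:Z.

Lemma quasi_periodic_A n : odd n -> quasi_periodic (Ahat n).
Proof.
move=> nodd; exists odd => X wv.
have n0 : (0 < n)%N by case: n nodd {wv}.
have hE : (n.+1 = 2 * n.+1./2)%N by lia.
have [||s sP] := @cyclic_wave n.+1./2 (fun p => X (p %% n.+1)%N).
- by move=> p k; rewrite -hE modnDr.
- move=> p k; rewrite (wave_neighbours _ _ wv) ?ltn_pmod //.
  rewrite /neighbour_sum /affine_edges big_map.
  set r := iota 0 n.+1; have ur : uniq r := iota_uniq 0 n.+1.
  have rE a : (a \in r) = (a < n.+1)%N by rewrite mem_iota add0n.
  rewrite big_split /= sum_if_eq // rE ltn_pmod // addrC; congr (_ + _); last first.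
    by congr (X _ _); rewrite -addn1 modnDml addn1.
  rewrite (eq_big_seq (fun a => if a == (p %% n.+1)%N then X a k.+1 else 0)).
    by rewrite sum_if_eq // rE ltn_pmod.
  move=> a; rewrite rE => aN /=.
  by rewrite -[in LHS](addn1 a) -(addn1 p) eqn_modDr [(a %% _)%N]modn_small.
- exists s => i k iN; have := sP i k.
  by rewrite modn_small // => ->; rewrite oddD mulr2n /=; lia.
Qed.

Lemma neighbour_sum_D n (X : nat -> int) i :
  neighbour_sum (affine_edges (Dhat n)) X i =
  (if i == 0%N then X 2%N else 0) + (if i == 2%N then X 0%N else 0) +
  (if i == (n - 2)%N then X n else 0) + (if i == n then X (n - 2)%N else 0) +
  (if (0 < i <= n - 2)%N then X i.+1 else 0) +
  (if (1 < i <= n - 1)%N && (2 < n)%N then X i.-1 else 0).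
Proof.
rewrite /neighbour_sum /affine_edges 2!big_cons big_map.
set r := iota 1 (n - 2); have ur : uniq r := iota_uniq 1 (n - 2).
have rE a : (a \in r) = (0 < a <= n - 2)%N by rewrite mem_iota; lia.
rewrite big_split /= sum_if_eq // rE.
have -> : \sum_(a <- r) (if a.+1 == i then X a else 0) =
          if (1 < i <= n - 1)%N && (2 < n)%N then X i.-1 else 0.
  rewrite (eq_bigr (fun a => if a == i.-1 then if (0 < i)%N then X a else 0 else 0)).
    rewrite (sum_if_eq (fun a => if (0 < i)%N then X a else 0)) // rE.
    by do !case: ifP; lia.
  by move=> a _; do !case: ifP; lia.
by rewrite ![_ == i]eq_sym !addrA.
Qed.

(** A chain with reflecting ends is the quotient of the cycle of length 2 m by a
    reflection fixing the vertices 0 and m. *)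
Lemma folded_chain_wave (m : nat) (y : nat -> nat -> int) : (0 < m)%N ->
  (forall k, y 0%N k.+2 + y 0%N k = y 1%N k.+1 *+ 2) ->
  (forall k, y m k.+2 + y m k = y m.-1 k.+1 *+ 2) ->
  (forall j k, (0 < j < m)%N -> y j k.+2 + y j k = y j.-1 k.+1 + y j.+1 k.+1) ->
  exists s : bool -> int, forall j k, (j <= m)%N ->
    y j (k + 2 * m)%N = y j k + s (odd (j + k)) *+ 2.
Proof.
move=> m0 y0 ym yj.
(* The values of [fold] beyond 2 m serve to read off p + 2 at the end of a period. *)
pose fold r := if (r <= m)%N then r else if (r <= 2 * m)%N then (2 * m - r)%N
  else (r - 2 * m)%N.
have foldE p c : (c <= m.*2)%N -> (p %% (2 * m) + c <= 2 * m + 1)%N ->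
    fold ((p + c) %% (2 * m))%N = fold (p %% (2 * m) + c)%N.
  move=> cm; rewrite -modnDml; set r := (p %% _)%N => rc.
  have [lt|ge] := ltnP (r + c) (2 * m); first by rewrite modn_small.
  rewrite -(subnK ge) modnDr modn_small /fold; last by lia.
  by do !case: ifP; lia.
have [||s sP] := @cyclic_wave m (fun p => y (fold (p %% (2 * m)))%N).
- by move=> p k; rewrite modnDr.
- move=> p k; have rm : (p %% (2 * m) < 2 * m)%N by rewrite ltn_pmod; lia.
  rewrite -(addn2 p) -(addn1 p) !foldE; try lia.
  set r := (p %% _)%N in rm *; rewrite addn1 addn2.
  have [lt|gt|eq] := ltngtP r.+1 m.
  + have -> : fold r = r by rewrite /fold; case: ifP; lia.
    have -> : fold r.+1 = r.+1 by rewrite /fold; case: ifP; lia.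
    have -> : fold r.+2 = r.+2 by rewrite /fold; case: ifP; lia.
    by rewrite yj //; lia.
  + have [lt'|] := ltnP r.+1 (2 * m).
      have -> : fold r = (2 * m - r.+1).+1 by rewrite /fold; do !case: ifP; lia.
      have -> : fold r.+1 = (2 * m - r.+1)%N by rewrite /fold; do !case: ifP; lia.
      have -> : fold r.+2 = (2 * m - r.+1).-1 by rewrite /fold; do !case: ifP; lia.
      by rewrite [RHS]addrC yj //; lia.
    move=> ge; have -> : fold r = 1%N by rewrite /fold; do !case: ifP; lia.
    have -> : fold r.+1 = 0%N by rewrite /fold; do !case: ifP; lia.
    have -> : fold r.+2 = 1%N by rewrite /fold; do !case: ifP; lia.
    by rewrite y0 mulr2n.
  + have -> : fold r = m.-1 by rewrite /fold; do !case: ifP; lia.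
    have -> : fold r.+1 = m by rewrite /fold; do !case: ifP; lia.
    have -> : fold r.+2 = m.-1 by rewrite /fold; do !case: ifP; lia.
    by rewrite ym mulr2n.
- exists s => j k jm; have := sP j k.
  by rewrite modn_small; [rewrite /fold jm|lia].
Qed.

(** Adding up the two leaves at each end turns a wave into a reflected wave on a
    chain of m + 1 vertices.  The difference of the two leaves changes sign every
    second step, hence has period 4; this is why the period doubles for odd n. *)
Lemma quasi_periodic_D n : (4 <= n)%N -> quasi_periodic (Dhat n).
Proof.
move=> n4; pose m := (n - 2)%N.
(* The position on the folded chain; its parity is the colour of the vertex. *)
pose pos i := if (i <= 1)%N then 0%N else if (n - 1 <= i)%N then m else i.-1.
exists (odd \o pos) => X wv.
have nb i k : (i <= n)%N -> X i k.+2 + X i k =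
    neighbour_sum (affine_edges (Dhat n)) (X^~ k.+1) i.
  by move=> iN; rewrite (wave_neighbours _ _ wv) //; lia.
have X0 k : X 0%N k.+2 + X 0%N k = X 2%N k.+1.
  by rewrite nb // neighbour_sum_D /=; do !case: ifP; lia.
have X1 k : X 1%N k.+2 + X 1%N k = X 2%N k.+1.
  by rewrite nb ?neighbour_sum_D /=; [do !case: ifP; lia|lia].
have Xn k : X n k.+2 + X n k = X m k.+1.
  by rewrite nb ?neighbour_sum_D //= -/m; do !case: ifP; lia.
have Xn1 k : X (n - 1)%N k.+2 + X (n - 1)%N k = X m k.+1.
  rewrite nb ?neighbour_sum_D /=; last by lia.
  have -> : (n - 1).-1 = m by lia.
  by do !case: ifP; lia.
(* Both ends of the folded chain are sums of two leaves, so they see their only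
   neighbour twice. *)
pose y j k := if j == 0%N then X 0%N k + X 1%N k
  else if j == m then X (n - 1)%N k + X n k else X j.+1 k.
have [||||s sP] := @folded_chain_wave m y.
- by lia.
- move=> k; rewrite /y /=; have := X0 k; have := X1 k.
  by case: ifP; lia.
- move=> k; rewrite /y eqxx; have := Xn k; have := Xn1 k.
  have -> : (m.-1.+1 = m)%N by lia.
  by do !case: ifP; lia.
- move=> j k jm; rewrite /y.
  have -> : (j == 0%N) = false by lia.
  have -> : (j == m) = false by lia.
  rewrite nb ?neighbour_sum_D; last by lia.
  have -> : (j.+1 == 0%N) = false by lia.
  have -> : (j.+1 == n)%N = false by lia.
  have -> : (j.+1.-1 = j)%N by lia.
  have -> : (j.+1 == n - 2)%N = (j.+1 == m) by lia.
  have -> : (0 < j.+1 <= n - 2)%N by lia.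
  have -> : (1 < j.+1 <= n - 1)%N && (2 < n)%N by lia.
  have -> : (j.+1 == 2%N) = (j.-1 == 0%N) by lia.
  have -> : (j.-1 == m) = false by lia.
  have [j1|j1] := eqVneq j.-1 0%N; have [jm1|jm1] := eqVneq j.+1 m.
  + have -> : j = 1%N by lia.
    have -> : (n - 1 = 3)%N by lia.
    have -> : n = 4%N by lia.
    by rewrite /=; lia.
  + have -> : j = 1%N by lia.
    by rewrite /=; lia.
  + have -> : (n - 1 = j.+2)%N by lia.
    rewrite prednK; last by lia.
    by rewrite /=; lia.
  rewrite prednK; last by lia.
  by rewrite /=; lia.
have flip (z : nat -> int) : (forall k, z k.+2 = - z k) ->
    forall k, z (k + 2 * h_a (Dhat n))%N = z k.
  move=> zP k; have z4 i : z (k + 4 * i)%N = z k.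
    elim: i => [|i IH]; first by rewrite muln0 addn0.
    by rewrite mulnS addnCA !addSn add0n !zP opprK IH.
  have -> : (2 * h_a (Dhat n) = 4 * (2 * h_a (Dhat n) %/ 4))%N.
    by rewrite /=; case: ifP; lia.
  exact: z4.
have z0P := flip (fun k => X 0%N k - X 1%N k)
  (fun k => ltac:(have := X0 k; have := X1 k; lia)).
have znP := flip (fun k => X (n - 1)%N k - X n k)
  (fun k => ltac:(have := Xn k; have := Xn1 k; lia)).
have yP j k : (j <= m)%N -> y j (k + 2 * h_a (Dhat n))%N =
    y j k + (theta (Dhat n))%:Z * s (odd (j + k)) *+ 2.
  move=> jm; rewrite /=; case: ifP => nodd.
    have -> : (k + 2 * (2 * (n - 2)) = k + 2 * m + 2 * m)%N by lia.
    rewrite !sP //; have -> : odd (j + (k + 2 * m)) = odd (j + k) by lia.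
    lia.
  by rewrite sP // mul1r.
exists s => i k iN; have z0 := z0P k; have zn := znP k.
have := yP 0%N k (leq0n _); have := yP m k (leqnn _).
rewrite /y /= eqxx /pos.
have -> : (m == 0%N) = false by lia.
set H := (k + _)%N in z0 zn *; set th := (if odd n then 2 else 1)%N.
move: z0 zn => /= z0 zn; rewrite -!oddD.
have [i2|i2] := leqP i 1.
  by case: i i2 {iN} => [|[|]] //=; lia.
have [ni|ni] := leqP (n - 1) i.
  have -> : (i < n.-1)%N = false by lia.
  have [->|->] : i = (n - 1)%N \/ i = n by move: iN => /=; lia.
    by rewrite /=; lia.
  by rewrite /=; lia.
have -> : (i < n.-1)%N by lia.
have := yP i.-1 k; rewrite /y.
have -> : (i.-1 == 0%N) = false by lia.
have -> : (i.-1 == m) = false by lia.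
rewrite prednK; last by lia.
rewrite /= -/H -/th => ih _ _; rewrite ih; last by lia.
by lia.
Qed.

(** * Waves on diagrams of type E *)

(** The iterated operators are opaque to computation; this version evaluates. *)
Definition neighbour_foldr (s : seq (nat * nat)) (X : nat -> int) i : int :=
  foldr (fun e acc => (if e.1 == i then X e.2 else 0) +
                      (if e.2 == i then X e.1 else 0) + acc) 0 s.

Lemma neighbour_foldrE s X i : neighbour_foldr s X i = neighbour_sum s X i.
Proof.
elim: s => [|e s IH]; first by rewrite /neighbour_sum big_nil.
by rewrite /neighbour_sum big_cons -/(neighbour_sum s X i) -IH.
Qed.

(** Row i of a table is the linear form expressing the value of a wave at the
    vertex i in terms of the 2 N initial values, those at time 0 followed by those
    at time 1. *)
Definition table := seq (seq int).
Definition entry (t : table) i b : int := nth 0 (nth [::] t i) b.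
Definition mktable N (f : nat -> nat -> int) : table :=
  mkseq (fun i => mkseq (f i) (2 * N)) N.

Lemma entry_mktable N f i b : (i < N)%N -> (b < 2 * N)%N ->
  entry (mktable N f) i b = f i b.
Proof. by move=> iN bN; rewrite /entry /mktable !nth_mkseq. Qed.

Definition first_tables N : table * table :=
  (mktable N (fun i b => (b == i)%:R), mktable N (fun i b => (b == N + i)%N%:R)).

Definition next_tables N s (t : table * table) : table * table :=
  (t.2, mktable N (fun i b =>
     neighbour_foldr s (fun j => entry t.2 j b) i - entry t.1 i b)).

(** The tables of the times k and k + 1. *)
Definition wave_tables N s k := iter k (next_tables N s) (first_tables N).

Definition eval_row N (w : nat -> int) (t : table) i : int :=
  \sum_(b < 2 * N) w b * entry t i b.

Definition initial_data N (X : nat -> nat -> int) b : int :=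
  if (b < N)%N then X b 0%N else X (b - N)%N 1%N.

Lemma eval_row_diff N w (t t0 u u0 : table) i p m :
  (forall b, (b < 2 * N)%N ->
     entry t i b = entry t0 i b + (entry u p b - entry u0 p b) *+ m) ->
  eval_row N w t i - eval_row N w t0 i =
  (eval_row N w u p - eval_row N w u0 p) *+ m.
Proof.
move=> E; rewrite /eval_row -!sumrB -sumrMnl; apply: eq_bigr => b _.
by rewrite E // -!mulrBr -mulrnAr addrAC subrr add0r.
Qed.

Lemma neighbour_sum_linear N s (w : nat -> int) (G : nat -> nat -> int) i :
  neighbour_sum s (fun j => \sum_(b < N) w b * G j b) i =
  \sum_(b < N) w b * neighbour_sum s (G^~ b) i.
Proof.
rewrite /neighbour_sum; under [RHS]eq_bigr do rewrite big_distrr /=.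
rewrite exchange_big /=; apply: eq_bigr => e _.
under [RHS]eq_bigr do rewrite mulrDr.
rewrite big_split /=; congr (_ + _).
  by case: ifP => _ //; rewrite big1 // => b _; rewrite mulr0.
by case: ifP => _ //; rewrite big1 // => b _; rewrite mulr0.
Qed.

Lemma eq_neighbour_sum N (s : seq (nat * nat)) (X Y : nat -> int) i :
  {in s, forall e, (e.1 < N)%N && (e.2 < N)%N} ->
  (forall j, (j < N)%N -> X j = Y j) -> neighbour_sum s X i = neighbour_sum s Y i.
Proof.
move=> sN XY; apply: eq_big_seq => e /sN /andP[e1 e2]; by rewrite !XY.
Qed.

Section Evolution.
Variable L : affine_type.
Hypothesis L_ADE : affine_ADE L.
Let N := affine_order L.
Let s := affine_edges L.

Lemma edges_lt : {in s, forall e, (e.1 < N)%N && (e.2 < N)%N}.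
Proof. by move=> e /(affine_edges_ok L_ADE) /andP[]. Qed.

Lemma wave_tablesP X k : wave L X -> forall i, (i < N)%N ->
  X i k = eval_row N (initial_data N X) (wave_tables N s k).1 i /\
  X i k.+1 = eval_row N (initial_data N X) (wave_tables N s k).2 i.
Proof.
move=> wv; elim: k => [|k IH] i iN.
  have ev f c : (c < 2 * N)%N -> (forall b, f i b = (b == c)%:R) ->
      eval_row N (initial_data N X) (mktable N f) i = initial_data N X c.
    move=> cN fE; rewrite /eval_row (bigD1 (Ordinal cN)) //=.
    rewrite entry_mktable // fE eqxx mulr1 big1 ?addr0 // => b.
    by rewrite -val_eqE /= entry_mktable // fE => /negPf->; rewrite mulr0.
  rewrite /=; split; [rewrite (ev _ i) //|rewrite (ev _ (N + i)%N) //]; try by lia.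
    by rewrite /initial_data iN.
  by rewrite /initial_data ltnNge leq_addr addKn.
split; first by have [_ ->] := IH i iN.
rewrite /wave_tables iterS -/(wave_tables N s k) /=.
set t := wave_tables N s k in IH *; rewrite /eval_row.
under eq_bigr => b _ do rewrite entry_mktable // neighbour_foldrE mulrBr.
rewrite sumrB -neighbour_sum_linear -/(eval_row N _ t.1 i).
have [<- _] := IH i iN; have := wave_neighbours k L_ADE wv iN.
rewrite (eq_neighbour_sum _ edges_lt (fun j jN => (IH j jN).2)) => <-.
by rewrite addrK.
Qed.

Lemma wave_ext (X Y : nat -> nat -> int) :
  (forall i k, (i < N)%N -> X i k.+2 + X i k = neighbour_sum s (X^~ k.+1) i) ->
  (forall i k, (i < N)%N -> Y i k.+2 + Y i k = neighbour_sum s (Y^~ k.+1) i) ->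
  (forall i, (i < N)%N -> X i 0%N = Y i 0%N /\ X i 1%N = Y i 1%N) ->
  forall k i, (i < N)%N -> X i k = Y i k.
Proof.
move=> wX wY XY k i iN.
suff [] : X i k = Y i k /\ X i k.+1 = Y i k.+1 by [].
elim: k i iN => [|k IH] i iN; first exact: XY.
have [e0 e1] := IH i iN; split=> //.
apply: (addIr (X i k)); rewrite wX // [in RHS]e0 wY //.
by apply: (eq_neighbour_sum _ edges_lt) => j jN; have [] := IH j jN.
Qed.

(** The increments over 2 h_a steps from the times 0 and 1, compared as linear
    forms with the marks times the increments at [p], which is meant to be a vertex
    of mark 1 and colour false.  The conditions on [c] and on the marks say that
    the expected increments form a wave, so the comparison at the two initial
    times decides all times. *)
Definition check_quasi_period (c : nat -> bool) p : bool :=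
  let t := wave_tables N s (2 * h_a L) in
  let t0 := first_tables N in
  let d b := entry t.1 p b - entry t0.1 p b in
  let d' b := entry t.2 p b - entry t0.2 p b in
  [&& (p < N)%N, all (fun e => c e.1 != c e.2) s,
      all (fun i => neighbour_foldr s (fun j => (marks L j)%:Z) i ==
                    (marks L i)%:Z *+ 2) (iota 0 N)
    & all (fun i => all (fun b =>
        (entry t.1 i b == entry t0.1 i b + (if c i then d' b else d b) *+ marks L i) &&
        (entry t.2 i b == entry t0.2 i b + (if c i then d b else d' b) *+ marks L i))
      (iota 0 (2 * N))) (iota 0 N)].

Lemma quasi_periodic_check c p : theta L = 1%N ->
  check_quasi_period c p -> quasi_periodic L.
Proof.
move=> th1 /and4P[pN /allP colP /allP harm /allP chk].
exists c => X wv; set H := (2 * h_a L)%N.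
pose sp (b : bool) : int := if b then X p (1 + H)%N - X p 1%N else X p H - X p 0%N.
exists sp => i k iN.
pose D i k := X i (k + H)%N - X i k.
suff : D i k = sp (c i (+) odd k) *+ marks L i.
  by rewrite /D => E; rewrite th1 mul1r -(natz (marks L i)) mulr_natr -E addrC subrK.
move: k i iN; apply: wave_ext.
- move=> i k iN; have e1 := wave_neighbours k L_ADE wv iN.
  have e2 := wave_neighbours (k + H) L_ADE wv iN.
  have -> : neighbour_sum s (D^~ k.+1) i =
      neighbour_sum s (X^~ (k + H).+1) i - neighbour_sum s (X^~ k.+1) i.
    rewrite /neighbour_sum -sumrB; apply: eq_bigr => e _; rewrite /D addSn.
    by do !case: ifP; lia.
  rewrite -e1 -e2 /D !addSn; lia.
- move=> i k iN; have /harm : i \in iota 0 N by rewrite mem_iota add0n.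
  rewrite neighbour_foldrE => /eqP mk.
  transitivity (sp (c i (+) odd k) * neighbour_sum s (fun j => (marks L j)%:Z) i).
    by rewrite mk /= negbK; lia.
  rewrite /neighbour_sum big_distrr /=; apply: eq_big_seq => e /colP ce.
  have flip a b : c a != c b -> c b (+) ~~ odd k = c a (+) odd k.
    by case: (c a) (c b) (odd k) => [] [] [].
  rewrite mulrDr; congr (_ + _); case: eqP => [<-|_]; rewrite ?mulr0 //.
    by rewrite (flip e.1) // -mulr_natr natz.
  by rewrite (flip e.2) 1?eq_sym // -mulr_natr natz.
move=> i iN; have /chk /allP {}chk : i \in iota 0 N by rewrite mem_iota add0n.
have [XH XH1] := wave_tablesP H wv iN; have [X0 X1] := wave_tablesP 0 wv iN.
have [pH pH1] := wave_tablesP H wv pN; have [p0 p1] := wave_tablesP 0 wv pN.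
rewrite /D add0n add1n XH XH1 X0 X1 /= addbF addbT /sp add1n pH pH1 p0 p1.
have bP b : (b < 2 * N)%N -> b \in iota 0 (2 * N) by rewrite mem_iota add0n.
have {}chk b (bN : (b < 2 * N)%N) := chk b (bP b bN).
by split; case: (c i) chk => chk; apply: eval_row_diff => b /chk /andP[/eqP ? /eqP ?].
Qed.

End Evolution.

Lemma quasi_periodic_E6 : quasi_periodic E6hat.
Proof.
by apply: (@quasi_periodic_check E6hat isT
  (nth false [:: false; true; false; true; false; true; false]) 0%N);
  last by vm_compute.
Qed.

Lemma quasi_periodic_E7 : quasi_periodic E7hat.
Proof.
by apply: (@quasi_periodic_check E7hat isT
  (nth false [:: false; true; false; true; false; true; false; false]) 0%N);
  last by vm_compute.
Qed.

Lemma quasi_periodic_E8 : quasi_periodic E8hat.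
Proof.
by apply: (@quasi_periodic_check E8hat isT
  (nth false [:: true; false; true; false; true; false; true; false; false]) 7%N);
  last by vm_compute.
Qed.

(** * Waves on affine diagrams and additive vectors *)

Definition bipartite_type (L : affine_type) := if L is Ahat n then odd n else true.

Lemma affine_quasi_periodic L : affine_ADE L -> bipartite_type L -> quasi_periodic L.
Proof.
case: L => [n|n|||] /= ok bip.
- exact: quasi_periodic_A.
- exact: quasi_periodic_D.
- exact: quasi_periodic_E6.
- exact: quasi_periodic_E7.
- exact: quasi_periodic_E8.
Qed.

Lemma h_a_gt0 L : affine_ADE L -> (0 < h_a L)%N.
Proof. by case: L => //= n n4; [lia|case: ifP; lia]. Qed.

Lemma marks1_exists L : affine_ADE L ->
  exists2 p, (p < affine_order L)%N & marks L p = 1%N.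
Proof.
case: L => [n|n|||] //= _; [by exists 0%N|by exists 0%N|by exists 0%N|by exists 0%N|].
by exists 7%N.
Qed.

(** A harmonic vector mu gives the wave k * mu, whose increments are known both
    directly, 2 h_a mu, and by quasi-periodicity, a multiple of the marks.  So the
    uniqueness of the additive vector needs no case analysis. *)
Lemma harmonic_marks L (mu : nat -> nat) : affine_ADE L -> bipartite_type L ->
  (forall i, (i < affine_order L)%N ->
     (2 * mu i = \sum_(j < affine_order L) affine_adj L i j * mu j)%N) ->
  exists d, forall i, (i < affine_order L)%N -> (mu i = d * marks L i)%N.
Proof.
move=> Lok Lb harm; have [c per] := affine_quasi_periodic Lok Lb.
have [|s sP] := per (fun i k => (mu i * k)%N%:Z).
  move=> i k iN; rewrite -PoszD.
  have -> : (mu i * k.+2 + mu i * k = (2 * mu i) * k.+1)%N by lia.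
  rewrite harm // big_distrl /= -natz natr_sum; apply: eq_bigr => j _.
  by rewrite natz -mulr_natr natz -PoszM; congr Posz; lia.
have h0 := h_a_gt0 Lok; have [p pN mp] := marks1_exists Lok.
(* The vertex [p] has mark 1, so its value is the proportionality factor. *)
exists (mu p) => i iN.
have eqn i' k : (i' < affine_order L)%N ->
    (mu i' * (2 * h_a L))%N%:Z = (theta L)%:Z * s (c i' (+) odd k) * (marks L i')%:Z.
  by move=> /(sP _ k); rewrite mulnDr PoszD => /addrI.
(* At the times [c i] and [c p], cast to 0 or 1, the same one of the two speeds
   applies to both vertices. *)
have := eqn i (c i) iN; have := eqn p (c p) pN.
rewrite !oddb !addbb mp mulr1 => <-; rewrite -PoszM => -[].
move: h0; set h := h_a L => h0 E; apply/eqP.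
by rewrite -(eqn_pmul2r (m := 2 * h)); [apply/eqP; lia|lia].
Qed.

(** * Eventual linearity on an affine component *)

(** The increments are nondecreasing integers, bounded by a since a larger one
    would force a growth faster than a; such a sequence is eventually constant. *)
Lemma convex_eventually_affine (S : nat -> int) (a b : int) :
  (forall k, S k.+1 *+ 2 <= S k.+2 + S k) -> (forall k, S k <= a * k%:Z + b) ->
  exists k0, forall k, (k0 <= k)%N -> S k.+2 + S k = S k.+1 *+ 2.
Proof.
move=> conv bnd; pose d k := S k.+1 - S k.
have mono k j : d k <= d (k + j)%N.
  elim: j => [|j IH]; first by rewrite addn0.
  by apply: le_trans IH _; rewrite addnS /d; have := conv (k + j)%N; lia.
have da k : d k <= a.
  rewrite leNgt; apply/negP => ak.
  have grow j : S k + (a + 1) * j%:Z <= S (k + j)%N.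
    elim: j => [|j IH]; first by rewrite mulr0 addr0 addn0.
    by have := mono k j; rewrite addnS /d; move: ak; rewrite /d; lia.
  pose j := `|(a * k%:Z + b - S k)%R|%N.+1.
  have := grow j; have := bnd (k + j)%N; rewrite /j; lia.
suff [k0 k0P] : exists k0, forall k, (k0 <= k)%N -> d k = d k0.
  exists k0 => k kk.
  by have := k0P k kk; have := k0P k.+1 (leqW kk); rewrite /d; lia.
have [m] := ubnP `|(a - d 0%N)%R|%N; move: 0%N => k1.
elim: m k1 => // m IH k1 km.
have [[k [kk ne]]|none] := classic (exists k, (k1 <= k)%N /\ d k != d k1); last first.
  exists k1 => k kk; apply/eqP; apply: contraT => ne.
  by case: none; exists k.
apply: (IH k); have := mono k1 (k - k1)%N; rewrite subnKC // => le.
by have := da k; move: km ne le; lia.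
Qed.

Section Component.
Variables (V : finType) (E : V -> V -> nat) (C : {set V}) (L : affine_type).
Hypothesis E_sym : forall u v, E u v = E v u.
Hypotheses (L_ADE : affine_ADE L) (C_comp : connected_component E C).
Hypothesis C_L : isomorphic_to E C L.
Variable mv : V -> nat.
Hypothesis mvP : additive_vector E C mv.
Variable eps : V -> bool.
Hypothesis eps_E : forall u v, (0 < E u v)%N -> eps u != eps v.

Lemma component_closed u v : v \in C -> (0 < E u v)%N -> u \in C.
Proof.
case: C_comp => x ->; rewrite !inE => xv uv.
by apply: connect_trans xv (connect1 _); rewrite /= E_sym.
Qed.

Lemma sum_component (X : V -> int) v : v \in C ->
  \sum_u X u *+ E u v = \sum_(u in C) X u *+ E u v.
Proof.
move=> vC; rewrite [RHS]big_mkcond /=; apply: eq_bigr => u _.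
case: ifPn => // uC; have [->//|uv] := posnP (E u v).
by rewrite (component_closed vC uv) in uC.
Qed.

(** Coordinates on the component by natural numbers, with the corresponding change
    of summation index, so that waves on the diagram apply. *)
Lemma component_coordinates : exists f : nat -> V,
  [/\ forall i, (i < affine_order L)%N -> f i \in C,
      forall v, v \in C -> exists2 i, (i < affine_order L)%N & f i = v,
      forall i j, (i < affine_order L)%N -> (j < affine_order L)%N ->
        E (f i) (f j) = affine_adj L i j &
      forall (R : nmodType) (G : V -> R),
        \sum_(u in C) G u = \sum_(j < affine_order L) G (f j)].
Proof.
have [g [g_inj gC gE]] := C_L.
have N0 : (0 < affine_order L)%N by case: (L).
pose f i := g (insubd (Ordinal N0) i).
have fg (i : 'I_(affine_order L)) : f i = g i by rewrite /f valKd.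
exists f; split.
- by move=> i iN; rewrite -gC imset_f.
- by move=> v; rewrite -gC => /imsetP[i _ ->]; exists i.
- by move=> i j iN jN; rewrite /f gE !val_insubd iN jN.
- move=> R G; rewrite -gC big_imset /=; last by move=> i j _ _; apply: g_inj.
  by apply: eq_big => [i|i _]; rewrite ?inE // fg.
Qed.

(** An odd cycle has no proper 2-colouring. *)
Lemma component_bipartite_type : bipartite_type L.
Proof.
have [f [_ _ fE _]] := component_coordinates.
move: L_ADE fE; case: (L) => [n|n|||] //= n0 fE.
have stp i : (i <= n)%N -> eps (f (i.+1 %% n.+1)%N) = ~~ eps (f i).
  move=> iN; suff /eps_E : (0 < E (f i) (f (i.+1 %% n.+1)%N))%N.
    by case: (eps _) (eps _) => [] [].
  rewrite fE ?ltn_pmod // /affine_adj -has_count; apply/hasP.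
  exists (i, (i.+1 %% n.+1)%N); last by rewrite eqxx.
  by apply: (map_f (fun i => (i, (i.+1 %% n.+1)%N))); rewrite mem_iota.
have par i : (i <= n)%N -> eps (f i) = eps (f 0%N) (+) odd i.
  elim: i => [|i IH] iN; first by rewrite addbF.
  have := stp i (ltnW iN); rewrite modn_small // IH 1?ltnW // => ->.
  by rewrite addbN.
have := stp n (leqnn n); rewrite modnn (par n) //.
by case: (eps _) (odd n) => [] [].
Qed.

Lemma additive_vector_marks f :
  (forall i, (i < affine_order L)%N -> f i \in C) ->
  (forall v, v \in C -> exists2 i, (i < affine_order L)%N & f i = v) ->
  (forall i j, (i < affine_order L)%N -> (j < affine_order L)%N ->
        E (f i) (f j) = affine_adj L i j) ->
  (forall (R : nmodType) (G : V -> R),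
        \sum_(u in C) G u = \sum_(j < affine_order L) G (f j)) ->
  forall i, (i < affine_order L)%N -> mv (f i) = marks L i.
Proof.
move=> fC Cf fE fsum; have [mv0 mv1 harm] := mvP.
have [|d dP] := @harmonic_marks L (mv \o f) L_ADE component_bipartite_type.
  move=> i iN; rewrite /= harm ?fC // [LHS](fsum nat) /=; apply: eq_bigr => j _.
  by rewrite E_sym fE.
suff d1 : d = 1%N by move=> i iN; rewrite -[mv _]/((mv \o f) i) dP // d1 mul1n.
apply/eqP; rewrite -dvdn1 -mv1; apply/dvdn_biggcdP => v /Cf[i iN <-].
by rewrite -[mv _]/((mv \o f) i) dP // dvdn_mulr.
Qed.

(** The second difference of the sum S weighted by [mv] is the weighted sum of the
    defects of the inequalities in the hypothesis; all of them are nonnegative and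
    S is eventually affine, so they eventually vanish. *)
Lemma eventually_affine_component (X : V -> nat -> int) :
  (forall v k, v \in C -> \sum_u X u k.+1 *+ E u v <= X v k.+2 + X v k) ->
  (forall v, exists a b : nat, forall k, X v k <= (a * k + b)%N%:Z) ->
  exists k0, forall v k, (k0 <= k)%N -> v \in C ->
    X v k.+2 + X v k = \sum_(u in C) X u k.+1 *+ E u v.
Proof.
move=> ineq bnd; have [mv0 mv1 harm] := mvP.
pose S k := \sum_(v in C) X v k *+ mv v.
have Sdiff k : S k.+2 + S k - S k.+1 *+ 2 =
    \sum_(v in C) (X v k.+2 + X v k - \sum_(u in C) X u k.+1 *+ E u v) *+ mv v.
  under [RHS]eq_bigr do rewrite mulrnBl mulrnDl.
  rewrite sumrB big_split /=; congr (_ - _); rewrite /S -sumrMnl.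
  under [RHS]eq_bigr do rewrite -sumrMnl.
  rewrite exchange_big /=; apply: eq_bigr => u uC.
  rewrite -mulrnA mulnC harm // -sumrMnr.
  by apply: eq_bigr => v vC; rewrite -mulrnA E_sym.
have term_ge0 v k : v \in C ->
    0 <= (X v k.+2 + X v k - \sum_(u in C) X u k.+1 *+ E u v) *+ mv v.
  by move=> vC; rewrite mulrn_wge0 // subr_ge0 -sum_component // ineq.
have [a [b Sab]] : exists a b : nat, forall k, S k <= (a * k + b)%N%:Z.
  rewrite /S; elim: (index_enum V) => [|v r [a [b ab]]].
    by exists 0%N, 0%N => k; rewrite big_nil.
  have [a' [b' ab']] := bnd v; exists (a + a' * mv v)%N, (b + b' * mv v)%N => k.
  rewrite big_cons; have := ab k; have := ab' k; case: ifP => _ leX ler.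
    have := @ler_wpM2r _ (mv v)%:Z isT _ _ leX.
    have -> : ((a + a' * mv v) * k + (b + b' * mv v))%N%:Z =
              (a' * k + b')%N%:Z * (mv v)%:Z + (a * k + b)%N%:Z by lia.
    by rewrite -mulr_natr natz => h; apply: lerD.
  by apply: le_trans ler _; rewrite lez_nat leq_add ?leq_mul ?leq_addr.
have [||k0 k0P] := @convex_eventually_affine S a b.
- by move=> k; rewrite -subr_ge0 Sdiff sumr_ge0 // => v; apply: term_ge0.
- by move=> k; rewrite (le_trans (Sab k)).
exists k0 => v k kk vC; apply/eqP; rewrite -subr_eq0.
have /eqP := Sdiff k; rewrite k0P // subrr eq_sym.
rewrite psumr_eq0 => [/allP/(_ v)|w]; last exact: term_ge0.
by rewrite mem_index_enum vC mulrn_eq0 eqn0Ngt mv0 //= => /(_ isT).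
Qed.

(** The last hypothesis identifies the two evolutions, of even and of odd parity,
    of the wave as one evolution shifted by one unit of time; it makes the two
    speeds equal. *)
Lemma eventually_quasi_periodic_component (X : V -> nat -> int) :
  (forall v k, v \in C -> \sum_u X u k.+1 *+ E u v <= X v k.+2 + X v k) ->
  (forall v, exists a b : nat, forall k, X v k <= (a * k + b)%N%:Z) ->
  (forall v, exists b, forall k, odd k = b -> X v k = X v k.+1) ->
  exists (s : int) k0, forall v k, (k0 <= k)%N -> v \in C ->
    X v (k + 2 * h_a L)%N = X v k + (theta L)%:Z * s * (mv v)%:Z.
Proof.
move=> ineq bnd pair.
have [k0 lin] := eventually_affine_component ineq bnd.
have [f [fC Cf fE fsum]] := component_coordinates.
have mkE := additive_vector_marks fC Cf fE fsum.
have [c per] := affine_quasi_periodic L_ADE component_bipartite_type.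
have [|s sP] := per (fun i k => X (f i) (k0 + k)%N).
  move=> i k iN; rewrite !addnS lin ?fC ?leq_addr //.
  by rewrite fsum; apply: eq_bigr => j _; rewrite E_sym fE.
have s01 : s true = s false.
  have [p pN mp] := marks1_exists L_ADE; have [b bP] := pair (f p).
  (* The first time at or after [k0] at which the value at [f p] repeats. *)
  pose k : nat := b (+) odd k0.
  have odk : odd (k0 + k) = b by rewrite oddD oddb addbC addbK.
  have := sP p k pN; have := sP p k.+1 pN; rewrite mp !mulr1 /=.
  have odk2 : odd (k0 + (k + 2 * h_a L)) = b by rewrite -odk; lia.
  rewrite addSn !addnS -(bP _ odk) -(bP _ odk2).
  move=> -> /addrI /(mulfI _) E'.
  have {E'} : s (c p (+) ~~ odd k) = s (c p (+) odd k).
    by apply: E'; case: (L) => // n; rewrite /=; case: ifP.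
  by case: (c p) (odd k) => [] [].
exists (s false), k0 => v k kk /Cf[i iN <-].
have := sP i (k - k0)%N iN; rewrite addnA subnKC // mkE // => ->.
by congr (_ + _ * _ * _); case: (_ (+) _).
Qed.

End Component.

(** * Removal of the parity condition, and the theorem *)

Section Straighten.
Variables (V : finType) (Q : quiver V) (eps : V -> bool) (tr : V -> int -> int).
Hypothesis Q_bip : bipartition Q eps.

(** Off the lattice, the value at the next time is used.  The recurrence then holds
    at all times: off the lattice it is that of the next time. *)
Definition straighten v t := if on_lattice eps v t then tr v t else tr v (t + 1).

Lemma straightenE v t : exists2 e : nat, straighten v t = tr v (t + e%:Z) &
  on_lattice eps v (t + e%:Z) /\
  forall j : nat, straighten v (t + (2 * j)%N%:Z) = tr v (t + e%:Z + (2 * j)%N%:Z).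
Proof.
have shift (j : nat) : on_lattice eps v (t + (2 * j)%N%:Z) = on_lattice eps v t.
  by rewrite /on_lattice; lia.
rewrite /straighten; have [on|off] := boolP (on_lattice eps v t).
  by exists 0%N; rewrite addr0 //; split=> // j; rewrite shift on.
exists 1%N => //; split=> [|j]; first by rewrite on_latticeD1.
by rewrite shift (negPf off) addrAC.
Qed.

Lemma straighten_off v t : ~~ on_lattice eps v t -> straighten v t = straighten v (t + 1).
Proof. by move=> off; rewrite /straighten on_latticeD1 (negPf off). Qed.

Lemma straighten_ge lam v t : tropical_T_system Q eps lam tr ->
  \sum_u straighten u t *+ Gamma Q eps u v <= straighten v (t + 1) + straighten v (t - 1).
Proof.
move=> [_ trP]; have adj u : (0 < Gamma Q eps u v)%N ->
    on_lattice eps u t = ~~ on_lattice eps v t.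
  by move=> /Gamma_adj; apply: on_lattice_adj.
have [on|off] := boolP (on_lattice eps v t).
  have off1 : ~~ on_lattice eps v (t + 1) by rewrite on_latticeD1 on.
  have := trP v (t + 1) off1; rewrite addrK /straighten on_latticeD1 on_latticeB1 on /=.
  rewrite subrK => ->; rewrite le_max; apply/orP; left.
  rewrite le_eqVlt; apply/orP; left; apply/eqP; apply: eq_bigr => u _.
  by have [->//|/adj->] := posnP (Gamma Q eps u v); rewrite on.
rewrite /straighten on_latticeD1 on_latticeB1 off /= trP // le_max; apply/orP; left.
rewrite le_eqVlt; apply/orP; left; apply/eqP; apply: eq_bigr => u _.
by have [->//|/adj->] := posnP (Gamma Q eps u v); rewrite off.
Qed.

End Straighten.

Theorem corollary4p2p3 (V : finType) (Q : quiver V) (eps : V -> bool)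
    (Q_bip : bipartition Q eps)
    (Q_rec : recurrent Q eps)
    (Q_int : zamolodchikov_integrable Q eps)
    (L : affine_type) (L_ADE : affine_ADE L)
    (C : {set V})
    (C_comp : connected_component (Gamma Q eps) C)
    (C_L : isomorphic_to (Gamma Q eps) C L)
    (mv : V -> nat) (mvP : additive_vector (Gamma Q eps) C mv)
    (lam : V -> int) (tr : V -> int -> int)
    (trP : tropical_T_system Q eps lam tr) :
  exists speed_p speed_m : int,
    (exists t0 : int, forall (t : int) (v : V), t0 <= t -> v \in C ->
       on_lattice eps v t ->
       tr v (t + (2 * h_a L)%N%:Z) =
         tr v t + (theta L)%:Z * speed_p * (mv v)%:Z) /\
    (exists t0 : int, forall (t : int) (v : V), t <= t0 -> v \in C ->
       on_lattice eps v t ->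
       tr v (t - (2 * h_a L)%N%:Z) =
         tr v t + (theta L)%:Z * speed_m * (mv v)%:Z).
Proof.
pose x := straighten eps tr.
have growth v : exists N c : nat, forall t,
    (exists2 j, (0 < j <= N)%N & x v t <= x v (t + (2 * j)%N%:Z) + c%:Z) /\
    (exists2 j, (j < N)%N &
       x v (t + (2 * N)%N%:Z) <= x v (t + (2 * j)%N%:Z) + c%:Z).
  have [T TP /(_ v)[N [J [J0 JN rec]]]] := Q_int.
  have [c cP] := recurrence_growth Q_bip TP trP J0 JN rec.
  exists N, c => t; rewrite /x; have [e -> [on xE]] := straightenE eps tr v t.
  have [[j jN le] [j' jN' le']] := cP _ on.
  by split; [exists j|exists j'] => //; rewrite !xE.
have x_off v t : ~~ on_lattice eps v t -> x v t = x v (t + 1) by apply: straighten_off.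
have x_ge v t := straighten_ge v t trP; rewrite -/x in x_ge.
have x_on v t : on_lattice eps v t -> x v t = tr v t by rewrite /x /straighten => ->.
have [|||sp [kp pP]] := @eventually_quasi_periodic_component V (Gamma Q eps) C L
  (Gamma_sym Q eps) L_ADE C_comp C_L mv mvP eps (@Gamma_adj _ Q eps) (fun v k => x v k%:Z).
- move=> v k _; have := x_ge v k.+1%:Z.
  have -> : k.+1%:Z + 1 = k.+2%:Z by lia.
  by have -> : k.+1%:Z - 1 = k%:Z by lia.
- move=> v; have [N [c cP]] := growth v; apply: (@lookback_linear_growth _ N c) => k.
  have [_ [j jN le]] := cP k%:Z; exists (N - j)%N; first by lia.
  have -> : (k + 2 * N - 2 * (N - j) = k + 2 * j)%N by lia.
  by rewrite !PoszD.
- move=> v; exists (~~ eps v) => k kv; rewrite -addn1 PoszD x_off //.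
  by rewrite /on_lattice; lia.
have [|||sm [km mP]] := @eventually_quasi_periodic_component V (Gamma Q eps) C L
  (Gamma_sym Q eps) L_ADE C_comp C_L mv mvP eps (@Gamma_adj _ Q eps) (fun v k => x v (- k%:Z)).
- move=> v k _; have := x_ge v (- k.+1%:Z).
  have -> : - k.+1%:Z + 1 = - k%:Z by lia.
  have -> : - k.+1%:Z - 1 = - k.+2%:Z by lia.
  by rewrite [X in _ <= X -> _]addrC.
- move=> v; have [N [c cP]] := growth v; apply: (@lookback_linear_growth _ N c) => k.
  have [[j jN le] _] := cP (- (k + 2 * N)%N%:Z); exists j => //.
  by have -> : - (k + 2 * N - 2 * j)%N%:Z = - (k + 2 * N)%N%:Z + (2 * j)%N%:Z by lia.
- move=> v; exists (eps v) => k kv.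
  have -> : - k%:Z = - k.+1%:Z + 1 by lia.
  by symmetry; apply: x_off; move: kv; rewrite /on_lattice; lia.
exists sp, sm; split.
  exists kp%:Z => t v tk vC on; have tE : t = `|t|%N%:Z by lia.
  have := pP v `|t|%N; rewrite PoszD -tE !x_on //.
    by apply=> //; lia.
  by move: on; rewrite /on_lattice; lia.
exists (- km%:Z) => t v tk vC on; have tE : t = - `|t|%N%:Z by lia.
have := mP v `|t|%N; rewrite PoszD opprD -tE !x_on //.
  by apply=> //; lia.
by move: on; rewrite /on_lattice; lia.
Qed.
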